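(* Consider the constant-coefficient system $E^{A}:=\mathfrak{N}^{Aa}_{~\alpha}\partial_a\phi^{\alpha}=0$. Suppose that: (i) The system is hyperbolic for the direction $n_a=\nabla_at$ and there is a constant $\vartheta<\frac{\pi}{2}$ such that, for all $k_a=(0,k_i)$ with $|k|=1$ and all $i\in\{1,\dots,q_{(k)}\}$, the canonical angles $\theta_j^{\lambda_i(k)}$ between $\Phi_L^{\lambda_i(k)}$ and $\Phi_R^{\lambda_i(k)}$ satisfy $\cos\theta_j^{\lambda_i(k)}\ge\cos\vartheta>0$ for $j=1,\dots,d_{\lambda_i(k)}$. (ii) All the constraints of the system come from Geroch fields, i.e. they are $\psi^\Gamma=C^{\Gamma0}_AE^A$, $\Gamma=1,\dots,c=e-u$, where the $C^{\Gamma a}_A$ satisfy $C^{\Gamma(a}_A\mathfrak{N}^{|A|b)}_{~\alpha}=0$ and $C^{\Gamma0}_A$ has maximal rank (there is no $X_\Gamma\neq0$ with $X_\Gamma C^{\Gamma0}_A=0$). (iii) The system may or may not admit extra Geroch fields $M^{\tilde\Delta a}_A$, that is, fields with $M^{\tilde\Delta(a}_A\mathfrak{N}^{|A|b)}_{~\alpha}=0$ and $M^{\tilde\Delta a}_A\mathfrak{N}^{A0}_{~\alpha}=0$; if it does, there is a finite family $M^{\tilde\Delta a}_A$ such that every field satisfying these two equations is a linear combination of its members. (iv) The integrability conditions $\partial_d(C^{\Gamma d}_AE^A)=L^{\Gamma}_{1A}E^A$ and $\partial_d(M^{\tilde\Delta d}_{\Gamma}C^{\Gamma0}_AE^A)=L^{\tilde\Delta}_{2A}E^A$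 hold identically in $\phi$ (off-shell), with some $L^{\Gamma}_{1A}$, $L^{\tilde\Delta}_{2A}$ depending on $(x,\phi,\partial\phi)$. (v) For each $k_i$ with $|k|=1$, the vectors $M^{\tilde\Delta i}_{\Gamma}k_i$ span the left kernel $\{X_\Gamma: X_\Gamma C^{\Gamma0}_A\mathfrak{N}^{Aj}_{~\alpha}k_j=0\}$ of $C^{\Gamma0}_A\mathfrak{N}^{Aj}_{~\alpha}k_j$ (if there are no fields $M$, this left kernel is trivial). Then the system admits a hyperbolization $h^{\beta}_{~A}(k)$ for which there is at least one strongly hyperbolic subsidiary system associated to the strongly hyperbolic evolution equations $h^{\beta}_{~A}(k)\tilde E^{A}=0$; that is, there exist a hyperbolization $h^{\beta}_{~A}(k)$ and some $N^{\Gamma}_{\tilde\Delta}(k)$ such that $$B^{\Gamma i}_{~\Delta}k_i:=C^{\Gamma i}_Ah^{A}_{~\Delta}(k)k_i+N^{\Gamma}_{\tilde\Delta}(k)M^{\tilde\Delta i}_{\Delta}k_i$$ is uniformly diagonalizable with real eigenvalues over all $k_i$ with $|k|=1$.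
   Context: Setting. $M$ is of dimension $n+1$, foliated by level sets of $t$ with adapted coordinates $(t,x^i)$, $i=1,\dots,n$; $n_a=\nabla_at=(1,0,\dots,0)$. Field indices $\alpha,\beta,\dots$ take $u$ values, equation indices $A,B,\dots$ take $e\ge u$ values, and $\Gamma,\Delta,\dots$ take $c:=e-u$ values; $\tilde\Delta$ numbers the extra fields $M$; repeated indices are summed; round brackets denote symmetrization of the two space-time indices (barred indices excluded). $\mathfrak{N}^{Aa}_{~\alpha}$ is a constant real array; accordingly $C^{\Gamma a}_A$ and $M^{\tilde\Delta a}_A$ are constant. An upper index $0$ means contraction with $n_a$; an upper index $i$ or $j$ denotes spatial components. Standing assumption: there are no algebraic constraints, i.e. no $X_A\ne0$ with $X_A\mathfrak{N}^{Aa}_{~\alpha}=0$. Wave vectors: $k_a=(0,k_i)$ real, normalized $|k|=1$ in a fixed positive definite norm. For each $k$, let $l_a(\lambda)=-\lambda n_a+k_a$, $\lambda\in\mathbb{C}$. Fourier form: $\tilde E^A:=\mathfrak{N}^{A0}_{~\alpha}\partial_t\tilde\phi^{\alpha}+\mathrm{i}\,\mathfrak{N}^{Ai}_{~\alpha}k_i\tilde\phi^{\alpha}$, where $\tilde\phi$ is the spatial Fourier transform. Hyperbolic (for $n_a$): (a) $\mathfrak{N}^{A0}_{~\alpha}$ has only trivial right kernel (no $\delta\phi^\alpha\neq0$ with $\mathfrak{N}^{A0}_{~\alpha}\delta\phi^\alpha=0$); (b) for each $k$ and each $\lambda\in\mathbb{C}$, if $\mathfrak{N}^{Aa}_{~\alpha}l_a(\lambda)$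 has a non-trivial right kernel then $\lambda\in\mathbb{R}$. Generalized eigenvalues: for each $k$, $\lambda_1(k)<\dots<\lambda_{q_{(k)}}(k)$ are the values of $\lambda$ for which $\mathfrak{N}^{Aa}_{~\alpha}l_a(\lambda)$ has non-trivial right kernel. $\Phi_R^{\lambda_i(k)}=\{\delta\phi^\alpha:\mathfrak{N}^{Aa}_{~\alpha}l_a(\lambda_i(k))\delta\phi^{\alpha}=0\}$, of dimension $d_{\lambda_i(k)}$, and $\Psi_L^{\lambda_i(k)}=\{X_A: X_A\mathfrak{N}^{Aa}_{~\alpha}l_a(\lambda_i(k))=0\}$. Fix a positive definite Hermitian form $G^{\alpha\beta}$, independent of $k$, with inverse $G_{\alpha\beta}$ defining the inner product on the space of $\delta\phi^\alpha$. $\Phi_L^{\lambda_i(k)}$ is the image of $\Psi_L^{\lambda_i(k)}$ under $X_A\mapsto X_A\mathfrak{N}^{A0}_{~\alpha}G^{\alpha\beta}$. The canonical (principal) angles $\theta_j^{\lambda_i(k)}\in[0,\pi/2]$, $j=1,\dots,d_{\lambda_i(k)}$, between $\Phi_L^{\lambda_i(k)}$ and $\Phi_R^{\lambda_i(k)}$ are those whose cosines are the singular values of the orthogonal projection $\Phi_R^{\lambda_i(k)}\to\Phi_L^{\lambda_i(k)}$. Uniformly diagonalizable with real eigenvalues: a family of square matrices $P(k)$, $|k|=1$, such that for each $k$ there is an invertible $T(k)$ with $P(k)=T(k)\Lambda(k)T(k)^{-1}$, $\Lambda(k)$ diagonal and real, and there is a constant $C>0$ independent of $k$ with $|T(k)|+|T(k)^{-1}|<C$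 (any fixed matrix norm). Reduction: $h^{\beta}_{~A}(k)$ (possibly depending on $k$) with $h^{\beta}_{~A}(k)\mathfrak{N}^{A0}_{~\alpha}=\delta^{\beta}_{\alpha}$. It is a hyperbolization if $A^{\beta i}_{~\alpha}k_i:=h^{\beta}_{~A}(k)\mathfrak{N}^{Ai}_{~\alpha}k_i$ is uniformly diagonalizable with real eigenvalues; then the evolution equations $h^{\beta}_{~A}(k)\tilde E^A=0$ are strongly hyperbolic. Given a reduction, $h^{A}_{~\Delta}(k)$ is determined by $C^{\Gamma0}_Ah^{A}_{~\Delta}=\delta^{\Gamma}_{\Delta}$ and $h^{\beta}_{~A}h^{A}_{~\Delta}=0$ (so $\begin{bmatrix}\mathfrak{N}^{A0}_{~\alpha}&h^A_{~\Delta}\end{bmatrix}$ is the inverse of the stacked matrix $\begin{bmatrix}h^\alpha_B\\C^{\Delta0}_B\end{bmatrix}$). One sets $M^{\tilde\Delta a}_{\Gamma}:=M^{\tilde\Delta a}_Ah^{A}_{~\Gamma}$ (which does not depend on the chosen reduction, since $M^{\tilde\Delta a}_A\mathfrak{N}^{A0}_{~\alpha}=0$). Subsidiary system: the evolution system for the Fourier-transformed constraints $\tilde\psi^\Gamma=C^{\Gamma0}_A\tilde E^A$ satisfied when $h^\beta_{~A}(k)\tilde E^A=0$, namely $\partial_t\tilde\psi^{\Gamma}+\mathrm{i}\big(C^{\Gamma i}_Ah^{A}_{~\Delta}(k)+N^{\Gamma}_{\tilde\Delta}(k)M^{\tilde\Delta i}_{\Delta}\big)k_i\tilde\psi^{\Delta}=0$,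 where $N^{\Gamma}_{\tilde\Delta}(k)$ can be freely chosen (the $N$ term is absent if there are no fields $M$). It is strongly hyperbolic if its principal symbol $B^{\Gamma i}_{~\Delta}k_i$ is uniformly diagonalizable with real eigenvalues. *)

(* Defs.v *)
From HB Require Import structures.
From mathcomp Require Import all_boot all_order all_algebra.
From mathcomp Require Import all_classical all_reals all_analysis.
From mathcomp Require Export sesquilinear spectral complex.
Import Order.TTheory GRing.Theory Num.Theory.
Import numFieldNormedType.Exports.

Set Implicit Arguments.
Unset Strict Implicit.
Unset Printing Implicit Defensive.

Local Open Scope ring_scope.
Local Open Scope complex_scope.
Local Open Scope sesquilinear_scope.

(* Conventions.
   - Space-time indices a range over 'I_n.+1; ord0 is t (so X ord0 is the
     contraction X^0 with n_a = (1,0,...,0)) and lift ord0 i is x^i.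
   - N^{Aa}_alpha is a |-> N a with N a of size (u + c) x u: rows are the
     e = u + c equation indices A, columns the field indices alpha.
   - C^{Gamma a}_A is a |-> C a, of size c x (u + c); a family of m fields
     M^{Delta a}_A is a |-> M a, of size m x (u + c), m = 0 meaning that there
     are none.
   - Covectors X_A are rows.  Vectors delta phi^alpha are columns when N acts on
     them, but subspaces are row spaces in the sense of mxalgebra, so Phi_R is
     stored transposed. *)

Notation cplx A := (map_mx (real_complex _) A).

Definition is_norm (R : realType) (n : nat) (nrm : 'rV[R]_n -> R) : Prop :=
  [/\ forall x, 0 <= nrm x,
      forall x, nrm x = 0 -> x = 0,
      forall (a : R) x, nrm (a *: x) = `|a| * nrm x
    & forall x y, nrm (x + y) <= nrm x + nrm y].

Section LinearAlgebra.
Variable R : realType.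

(* X^i k_i *)
Definition spatial (n p q : nat) (X : 'I_n.+1 -> 'M[R]_(p, q)) (k : 'rV[R]_n) :
    'M[R]_(p, q) :=
  \sum_(i < n) k 0 i *: X (lift ord0 i).

(* N^{Aa}_alpha l_a(lambda) with l_a(lambda) = - lambda n_a + k_a *)
Definition pencil (n p q : nat) (N : 'I_n.+1 -> 'M[R]_(p, q)) (k : 'rV[R]_n)
    (lambda : R[i]) : 'M[R[i]]_(p, q) :=
  - lambda *: cplx (N ord0) + cplx (spatial N k).

Definition has_right_kernel (F : fieldType) (p q : nat) (A : 'M[F]_(p, q)) : Prop :=
  exists2 v : 'cV[F]_q, v != 0 & A *m v = 0.

Definition no_algebraic_constraints (n p q : nat) (N : 'I_n.+1 -> 'M[R]_(p, q)) : Prop :=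
  forall X : 'rV[R]_p, (forall a, X *m N a = 0) -> X = 0.

Definition generalized_eigenvalue (n p q : nat) (N : 'I_n.+1 -> 'M[R]_(p, q))
    (k : 'rV[R]_n) (lambda : R[i]) : Prop :=
  has_right_kernel (pencil N k lambda).

Definition hyperbolic (n p q : nat) (nrm : 'rV[R]_n -> R)
    (N : 'I_n.+1 -> 'M[R]_(p, q)) : Prop :=
  ~ has_right_kernel (N ord0) /\
  forall (k : 'rV[R]_n) (lambda : R[i]), nrm k = 1 ->
    generalized_eigenvalue N k lambda -> lambda \is Num.real.

(* G is the matrix (G^{alpha beta}), a form on covectors. *)
Definition posdef_hermitian (u : nat) (G : 'M[R[i]]_u) : Prop :=
  G \is hermsymmx /\
  forall w : 'rV[R[i]]_u, w != 0 -> 0 < form_of_matrix Num.conj G w w.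

(* The inner product <v, w> = v^alpha G_{alpha beta} conj(w^beta) is
   form_of_matrix Num.conj (invmx G).  With it <X N^0 G, w> = X N^0 conj(w), so
   that raising the index of X_A N^{A0}_alpha by a linear contraction with
   G^{alpha beta} is consistent with the sesquilinear pairing. *)
Definition gram (u p : nat) (G : 'M[R[i]]_u) (V : 'M[R[i]]_(p, u)) : 'M[R[i]]_p :=
  V *m invmx G *m V ^t*.

(* Orthogonal projection onto the row space of W; it acts on rows by *m. *)
Definition ortho_proj (u p : nat) (G : 'M[R[i]]_u) (W : 'M[R[i]]_(p, u)) : 'M[R[i]]_u :=
  proj_mx <<W>>%MS (orthomx Num.conj (invmx G) W).

(* s lists, with multiplicity, the singular values of v |-> v *m P restricted to
   the row space of S: V is an orthonormal basis of right singular vectors, whose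
   images are pairwise orthogonal with norms s_j. *)
Definition singular_values (u q : nat) (G : 'M[R[i]]_u) (P : 'M[R[i]]_u)
    (S : 'M[R[i]]_(q, u)) (s : 'I_(\rank S) -> R) : Prop :=
  (forall j, 0 <= s j) /\
  exists V : 'M[R[i]]_(\rank S, u),
    [/\ (V :=: S)%MS, gram G V = 1%:M
      & gram G (V *m P) = diag_mx (\row_j ((s j) ^+ 2)%:C)].

Definition canonical_angles (u p q : nat) (G : 'M[R[i]]_u) (L : 'M[R[i]]_(p, u))
    (S : 'M[R[i]]_(q, u)) (theta : 'I_(\rank S) -> R) : Prop :=
  (forall j, 0 <= theta j <= pi / 2) /\
  singular_values G (ortho_proj G L) (fun j => cos (theta j)).

Definition PhiR (n p q : nat) (N : 'I_n.+1 -> 'M[R]_(p, q)) (k : 'rV[R]_n)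
    (lambda : R[i]) : 'M[R[i]]_q :=
  kermx (pencil N k lambda)^T.

Definition PsiL (n p q : nat) (N : 'I_n.+1 -> 'M[R]_(p, q)) (k : 'rV[R]_n)
    (lambda : R[i]) : 'M[R[i]]_p :=
  kermx (pencil N k lambda).

Definition PhiL (n p q : nat) (N : 'I_n.+1 -> 'M[R]_(p, q)) (G : 'M[R[i]]_q)
    (k : 'rV[R]_n) (lambda : R[i]) : 'M[R[i]]_(p, q) :=
  PsiL N k lambda *m cplx (N ord0) *m G.

Definition uniform_angle_bound (n p q : nat) (nrm : 'rV[R]_n -> R)
    (N : 'I_n.+1 -> 'M[R]_(p, q)) (G : 'M[R[i]]_q) : Prop :=
  exists vartheta : R,
    [/\ vartheta < pi / 2, 0 < cos vartheta
      & forall (k : 'rV[R]_n) (lambda : R[i]), nrm k = 1 ->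
          generalized_eigenvalue N k lambda ->
          forall theta : 'I_(\rank (PhiR N k lambda)) -> R,
            canonical_angles G (PhiL N G k lambda) theta ->
            forall j, cos vartheta <= cos (theta j)].

(* `|T| is the maximum of the moduli of the entries of T. *)
Definition uniformly_diagonalizable (n p : nat) (nrm : 'rV[R]_n -> R)
    (P : 'rV[R]_n -> 'M[R[i]]_p) : Prop :=
  exists2 K : R, 0 < K &
    forall k : 'rV[R]_n, nrm k = 1 ->
      exists (T : 'M[R[i]]_p) (Lambda : 'rV[R]_p),
        [/\ T \in unitmx,
            P k = T *m diag_mx (cplx Lambda) *m invmx T
          & `|T| + `|invmx T| < K%:C].

End LinearAlgebra.

(* Y^{(a} N^{b)} = 0 for every member of the family Y *)
Definition geroch_fields (R : realType) (n p q r : nat) (N : 'I_n.+1 -> 'M[R]_(p, q))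
    (Y : 'I_n.+1 -> 'M[R]_(r, p)) : Prop :=
  forall a b, Y a *m N b + Y b *m N a = 0.

Definition extra_geroch_fields (R : realType) (n p q r : nat)
    (N : 'I_n.+1 -> 'M[R]_(p, q)) (Y : 'I_n.+1 -> 'M[R]_(r, p)) : Prop :=
  geroch_fields N Y /\ forall a, Y a *m N ord0 = 0.

(* h^A_Delta: the last c columns of the inverse of the stacked matrix [h; C^0]. *)
Definition companion (F : fieldType) (u c : nat) (h : 'M[F]_(u, u + c))
    (C0 : 'M[F]_(c, u + c)) : 'M[F]_(u + c, c) :=
  rsubmx (invmx (col_mx h C0)).

Lemma companionP (F : fieldType) (u c : nat) (N0 : 'M[F]_(u + c, u))
    (h : 'M[F]_(u, u + c)) (C0 : 'M[F]_(c, u + c)) :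
  h *m N0 = 1%:M -> C0 *m N0 = 0 -> row_free C0 ->
  [/\ C0 *m companion h C0 = 1%:M, h *m companion h C0 = 0
    & N0 *m h + companion h C0 *m C0 = 1%:M].
Proof.
move=> hN CN Cf.
have Uu : col_mx h C0 \in unitmx.
  rewrite -row_free_unit; apply/row_freeP.
  have [D CD] := row_freeP Cf.
  exists (row_mx N0 (D - N0 *m (h *m D))).
  rewrite mul_col_row hN CN !mulmxBr CD [h *m (N0 *m _)]mulmxA hN mul1mx subrr.
  by rewrite [C0 *m (N0 *m _)]mulmxA CN mul0mx subr0 -scalar_mx_block.
have E := mulmxV Uu.
rewrite -[X in _ *m X]hsubmxK mul_col_row -/(companion h C0) scalar_mx_block in E.
have [_ hH _ CH] := eq_block_mx E.
have E1 : col_mx h C0 *m row_mx N0 (companion h C0) = 1%:M.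
  by rewrite mul_col_row hN CN CH hH -scalar_mx_block.
by split=> //; rewrite -mul_row_col (mulmx1C E1).
Qed.

(* M^a_Gamma = M^a_A h^A_Gamma, computed with the reduction pinvmx N^0 (a left
   inverse of N^0 as soon as N^0 has trivial right kernel); by
   reduced_fieldE every other reduction gives the same matrix. *)
Definition reduced_field (R : realType) (n u c m : nat)
    (N : 'I_n.+1 -> 'M[R]_(u + c, u)) (C : 'I_n.+1 -> 'M[R]_(c, u + c))
    (M : 'I_n.+1 -> 'M[R]_(m, u + c)) (a : 'I_n.+1) : 'M[R]_(m, c) :=
  M a *m companion (pinvmx (N ord0)) (C ord0).

Lemma reduced_fieldE (R : realType) (n u c m : nat)
    (N : 'I_n.+1 -> 'M[R]_(u + c, u)) (C : 'I_n.+1 -> 'M[R]_(c, u + c))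
    (M : 'I_n.+1 -> 'M[R]_(m, u + c)) (h : 'M[R[i]]_(u, u + c)) (a : 'I_n.+1) :
  h *m cplx (N ord0) = 1%:M -> C ord0 *m N ord0 = 0 -> row_free (C ord0) ->
  M a *m N ord0 = 0 ->
  cplx (M a) *m companion h (cplx (C ord0)) = cplx (reduced_field N C M a).
Proof.
move=> hN CN Cf MN.
have fN : row_full (N ord0).
  by rewrite -(row_full_map (real_complex R)); apply/row_fullP; exists h.
have [CH hH _] := companionP (mulVpmx fN) CN Cf.
have CNc : cplx (C ord0) *m cplx (N ord0) = 0 by rewrite -map_mxM CN map_mx0.
have Cfc : row_free (cplx (C ord0)) by rewrite row_free_map.
have [CHc hHc Ec] := companionP hN CNc Cfc.
have [_ _ E] := companionP (mulVpmx fN) CN Cf.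
have MHC : M a = reduced_field N C M a *m C ord0.
  by rewrite -[LHS]mulmx1 -E mulmxDr !mulmxA MN !mul0mx add0r.
by rewrite {1}MHC map_mxM -mulmxA CHc mulmx1.
Qed.

Section Fields.
Variables (R : realType) (n : nat).

Definition partial (a : 'I_n.+1) (f : 'rV[R]_n.+1 -> R) (x : 'rV[R]_n.+1) : R :=
  'D_(delta_mx 0 a) f x.

Fixpoint Ck (r : nat) (f : 'rV[R]_n.+1 -> R) : Prop :=
  continuous f /\
  if r is r'.+1 then
    forall a, (forall x, derivable f x (delta_mx 0 a)) /\ Ck r' (partial a f)
  else True.

Definition smooth_field (u : nat) (phi : 'rV[R]_n.+1 -> 'cV[R]_u) : Prop :=
  forall r alpha, Ck r (fun x => phi x alpha 0).

(* (alpha, a) |-> d_a phi^alpha *)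
Definition jacobi (u : nat) (phi : 'rV[R]_n.+1 -> 'cV[R]_u) (x : 'rV[R]_n.+1) :
    'M[R]_(u, n.+1) :=
  \matrix_(alpha < u, a < n.+1) partial a (fun y => phi y alpha 0) x.

(* E^A = N^{Aa}_alpha d_a phi^alpha *)
Definition field_eq (e u : nat) (N : 'I_n.+1 -> 'M[R]_(e, u))
    (phi : 'rV[R]_n.+1 -> 'cV[R]_u) (x : 'rV[R]_n.+1) : 'cV[R]_e :=
  \sum_a N a *m col a (jacobi phi x).

(* d_d (Y^{Gamma d}_A E^A) = L^Gamma_A(x, phi, d phi) E^A identically in phi *)
Definition integrability (e u r : nat) (N : 'I_n.+1 -> 'M[R]_(e, u))
    (Y : 'I_n.+1 -> 'M[R]_(r, e)) : Prop :=
  exists L : 'rV[R]_n.+1 -> 'cV[R]_u -> 'M[R]_(u, n.+1) -> 'M[R]_(r, e),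
    forall phi, smooth_field phi -> forall x Gamma,
      \sum_d partial d (fun y => (Y d *m field_eq N phi y) Gamma 0) x =
      (L x (phi x) (jacobi phi x) *m field_eq N phi x) Gamma 0.

End Fields.

Section Reductions.
Variables (R : realType) (n u c : nat) (nrm : 'rV[R]_n -> R).
Variable N : 'I_n.+1 -> 'M[R]_(u + c, u).

(* Reductions act on Fourier modes and may be complex. *)
Definition reduction (h : 'rV[R]_n -> 'M[R[i]]_(u, u + c)) : Prop :=
  forall k, nrm k = 1 -> h k *m cplx (N ord0) = 1%:M.

Definition evolution_symbol (h : 'rV[R]_n -> 'M[R[i]]_(u, u + c)) (k : 'rV[R]_n) :
    'M[R[i]]_u :=
  h k *m cplx (spatial N k).

Definition hyperbolization (h : 'rV[R]_n -> 'M[R[i]]_(u, u + c)) : Prop :=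
  reduction h /\ uniformly_diagonalizable nrm (evolution_symbol h).

(* B^{Gamma i}_Delta k_i; Q is the free matrix N^Gamma_Delta(k), and the last term
   vanishes when m = 0. *)
Definition subsidiary_symbol (m : nat) (C : 'I_n.+1 -> 'M[R]_(c, u + c))
    (M : 'I_n.+1 -> 'M[R]_(m, u + c)) (h : 'rV[R]_n -> 'M[R[i]]_(u, u + c))
    (Q : 'rV[R]_n -> 'M[R[i]]_(c, m)) (k : 'rV[R]_n) : 'M[R[i]]_c :=
  cplx (spatial C k) *m companion (h k) (cplx (C ord0)) +
  Q k *m cplx (spatial (reduced_field N C M) k).

End Reductions.

(* Main.v *)
Require Import Defs.
From HB Require Import structures.
From mathcomp Require Import all_boot all_order all_algebra.
From mathcomp Require Import all_classical all_reals all_analysis.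
Import Order.TTheory GRing.Theory Num.Theory.
Import numFieldNormedType.Exports.

Set Implicit Arguments.
Unset Strict Implicit.
Unset Printing Implicit Defensive.

Local Open Scope ring_scope.
Local Open Scope complex_scope.
Local Open Scope sesquilinear_scope.

(** Fix a unit wave vector k and write N0 and K for the time and the spatial part
    of the principal symbol, h0 for any left inverse of N0, A = h0 K for the
    corresponding evolution symbol and V = C0 K for the symbol of the constraints.
    Every other reduction is h0 + Y C0 with Y free, and its evolution symbol is
    A + Y V.

    The Geroch identities contracted with k say that S N0 = - V and S K = 0, where
    S is the spatial symbol of C.  Splitting K along N0 h0 + H C0 = 1, where H is
    the companion of h0, turns them into the intertwining relation V A = B0 V with
    B0 = S H ([constraint_intertwining]), valid for every reduction.  It has two
    consequences.

    First, ker V is stable under A, and the eigenvectors of A in ker V are exactly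
    the non-zero vectors of the spaces Phi_R.  The angle bound provides for each
    generalized eigenvalue l a projection P_l onto Phi_R^l, of the form X N0 with
    the rows of X in Psi_L^l, whose norm is bounded uniformly in k and l
    ([eigenprojection_bound]): the singular value decomposition of the orthogonal
    projection onto Phi_L^l, whose singular values are the cosines of the angles,
    yields an orthonormal basis of Phi_R^l and a bounded dual basis taken in
    Phi_L^l.  Such projections annihilate each other, and they add up to the
    identity on ker V: otherwise ker V would contain a non-zero
    stable subspace annihilated by all of them, hence an eigenvector annihilated by
    its own projection ([eigenprojections_span]).  Therefore D = sum_l l P_l
    agrees with A on ker V, D - A factors through V, and some reduction h has
    evolution symbol D ([reduction_to_eigenprojections]).  The matrix D is
    diagonalizable with constants that depend only on u and the bound on
    the P_l, because sum_l P_l^* P_l + P_0^* P_0, with P_0 = 1 - sum_l P_l, is a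
    bounded symmetrizer ([diag_of_idempotents]).

    Second, for this h the intertwining relation reads B0 V = V D, and V D = 0
    because V P_l = l C0 N0 P_l = 0.  So the rows of B0 lie in the left kernel of V,
    which is spanned by the rows of the symbol of the reduced fields M: a suitable
    Q makes the subsidiary symbol B0 + Q M vanish identically
    ([constraint_symbol_cancel]), and the zero symbol is uniformly
    diagonalizable. *)

(** * Hermitian forms *)

Section HermitianForms.
Variable R : realType.
Local Notation C := R[i].

Lemma adjM m n p (A : 'M[C]_(m, n)) (B : 'M[C]_(n, p)) :
  (A *m B)^t* = B^t* *m A^t*.
Proof. by rewrite trmx_mul map_mxM. Qed.

Lemma adjD m n (A B : 'M[C]_(m, n)) : (A + B)^t* = A^t* + B^t*.
Proof. by rewrite linearD map_mxD. Qed.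

Lemma adj_eq0 m n (A : 'M[C]_(m, n)) : A^t* = 0 -> A = 0.
Proof. by move=> A0; rewrite -[A]trmxCK A0 trmx0 map_mx0. Qed.

Lemma adj_diag_real n (d : 'rV[C]_n) : d \is a realmx ->
  (diag_mx d)^t* = diag_mx d.
Proof. by move=> d_real; rewrite tr_diag_mx map_diag_mx realmxC. Qed.

Lemma hermsymP n (A : 'M[C]_n) : reflect (A^t* = A) (A \is hermsymmx).
Proof.
by apply: (iffP (is_hermitianmxP _ _ _)); rewrite expr0 scale1r => E; exact: esym.
Qed.

Lemma formE n (A : 'M[C]_n) (v w : 'rV[C]_n) :
  form_of_matrix Num.conj A v w = (v *m A *m w^t*) 0 0.
Proof. exact: trace_mx11. Qed.

Lemma sandwichM m n p (A : 'M[C]_p) (U : 'M[C]_(m, n)) (S : 'M[C]_(n, p)) :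
  U *m S *m A *m (U *m S)^t* = U *m (S *m A *m S^t*) *m U^t*.
Proof. by rewrite adjM !mulmxA. Qed.

Lemma hermsym_congr m n (A : 'M[C]_n) (S : 'M[C]_(m, n)) :
  A \is hermsymmx -> S *m A *m S^t* \is hermsymmx.
Proof.
by move=> /hermsymP A_herm; apply/hermsymP; rewrite !adjM A_herm trmxCK mulmxA.
Qed.

Lemma posdef_congr m n (A : 'M[C]_n) (S : 'M[C]_(m, n)) :
  row_free S -> posdef_hermitian A -> posdef_hermitian (S *m A *m S^t*).
Proof.
move=> S_free [A_herm A_pos]; split=> [|w w_neq0]; first exact: hermsym_congr.
have := A_pos (w *m S); rewrite mulmx_free_eq0 // => /(_ w_neq0).
by rewrite !formE adjM !mulmxA.
Qed.

Lemma posdef_unit n (A : 'M[C]_n) : posdef_hermitian A -> A \in unitmx.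
Proof.
move=> [_ A_pos]; rewrite -row_free_unit -kermx_eq0; apply/eqP/row_matrixP => i.
rewrite row0; apply/eqP; apply: contraT => /A_pos.
have /sub_kermxP E : (row i (kermx A) <= kermx A)%MS by exact: row_sub.
by rewrite formE E mul0mx mxE ltxx.
Qed.

Lemma posdef_inv n (A : 'M[C]_n) : posdef_hermitian A -> posdef_hermitian (invmx A).
Proof.
move=> A_pos; have A_unit := posdef_unit A_pos.
have /hermsymP A_herm := A_pos.1.
have -> : invmx A = invmx A *m A *m (invmx A)^t*.
  rewrite mulVmx // mul1mx -[LHS]mulmx1.
  have -> : 1%:M = A *m (invmx A)^t*.
    by rewrite -{1}A_herm -adjM mulVmx // trmx1 map_mx1.
  by rewrite mulKmx.
by apply: posdef_congr => //; rewrite row_free_unit unitmx_inv.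
Qed.

Lemma form_ge0 n (A : 'M[C]_n) (w : 'rV[C]_n) :
  posdef_hermitian A -> 0 <= form_of_matrix Num.conj A w w.
Proof.
move=> [_ A_pos]; have [->|/A_pos/ltW//] := eqVneq w 0.
by rewrite formE !mul0mx mxE.
Qed.

Lemma gram_diag m n (A : 'M[C]_n) (S : 'M[C]_(m, n)) i :
  (S *m A *m S^t*) i i = form_of_matrix Num.conj A (row i S) (row i S).
Proof.
rewrite formE -row_mul !mxE; apply: eq_bigr => j _.
by rewrite !mxE.
Qed.

(** The unitary diagonalization of A, rescaled by the square roots of its positive
    eigenvalues, turns A into the identity; a second unitary change of basis then
    diagonalizes B without disturbing it. *)
Lemma posdef_simultaneous_diag n (A B : 'M[C]_n) :
  posdef_hermitian A -> B \is hermsymmx ->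
  exists (T : 'M[C]_n) (Lambda : 'rV[R]_n),
    [/\ T \in unitmx, T *m A *m T^t* = 1%:M
      & T *m B *m T^t* = diag_mx (cplx Lambda)].
Proof.
move=> A_pos B_herm.
have /hermitian_normalmx/orthomx_spectralP A_eq := A_pos.1.
set P := spectralmx A in A_eq; set d := spectral_diag A in A_eq.
have P_unit : P \in unitmx by exact: spectral_unit.
have PP : P *m P^t* = 1%:M by apply/unitarymxP; exact: spectral_unitarymx.
have PA : P *m A *m P^t* = diag_mx d.
  by rewrite A_eq !mulmxA mulmxV // mul1mx -mulmxA PP mulmx1.
have d_pos j : 0 < d 0 j.
  have PA_pos : posdef_hermitian (P *m A *m P^t*).
    by apply: posdef_congr => //; rewrite row_free_unit.
  have /PA_pos.2 : 'e_j != 0 :> 'rV[C]_n.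
    apply/eqP => /matrixP/(_ 0 j); rewrite !mxE !eqxx.
    by move/eqP; rewrite oner_eq0.
  by rewrite rV_formee PA !mxE eqxx mulr1n.
pose e := \row_j (sqrtC (d 0 j))^-1.
have e_pos j : 0 < e 0 j by rewrite mxE invr_gt0 sqrtC_gt0.
have e_real : e \is a realmx.
  by apply/mxOverP => i j; rewrite ord1 gtr0_real.
pose S := diag_mx e *m P.
have S_unit : S \in unitmx.
  rewrite unitmx_mul P_unit andbT unitmxE det_diag unitfE.
  by apply/prodf_neq0 => j _; rewrite gt_eqF.
have SA : S *m A *m S^t* = 1%:M.
  rewrite sandwichM PA (adj_diag_real e_real) !mulmx_diag.
  apply/matrixP => i j; rewrite !mxE.
  case: (i =P j) => [->|_]; rewrite ?mulr0n // !mulr1n.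
  rewrite mulrAC -expr2 exprVn sqrtCK mulVf //.
  by rewrite gt_eqF.
have SB_herm : S *m B *m S^t* \is hermsymmx by exact: hermsym_congr.
have /hermitian_normalmx/orthomx_spectralP SB_eq := SB_herm.
set U := spectralmx _ in SB_eq; set l := spectral_diag _ in SB_eq.
have U_unit : U \in unitmx by exact: spectral_unit.
have UU : U *m U^t* = 1%:M by apply/unitarymxP; exact: spectral_unitarymx.
have l_real : l \is a realmx by exact: hermitian_spectral_diag_real.
exists (U *m S), (\row_j complex.Re (l 0 j)); split.
- by rewrite unitmx_mul U_unit.
- by rewrite sandwichM SA mulmx1.
rewrite sandwichM SB_eq.
rewrite !mulmxA mulmxV // mul1mx -mulmxA UU mulmx1; congr diag_mx.
by apply/rowP => j; rewrite !mxE RRe_real //; apply: (mxOverP l_real).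
Qed.

End HermitianForms.

(** * Bounds in the entrywise norm *)

Section EntrywiseNorm.
Variable R : realType.
Local Notation C := R[i].

Lemma ler_mx_entry m n (A : 'M[C]_(m, n)) i j : `|A i j| <= `|A|.
Proof.
rewrite [leRHS]/Num.norm /= mx_normE -[leLHS]nngE num_le.
exact: (le_bigmax _ (fun k : 'I_m * 'I_n => `|A k.1 k.2|%:nng) (i, j)).
Qed.

Lemma mx_norm_le m n (A : 'M[C]_(m, n)) (K : C) :
  0 <= K -> (forall i j, `|A i j| <= K) -> `|A| <= K.
Proof.
move=> K_ge0 A_le; rewrite [leLHS]/Num.norm /= mx_normE.
have -> : K = (NngNum K_ge0)%:num by [].
by rewrite num_le; apply/bigmax_leP; split=> [|[i j] _]; rewrite -num_le //=.
Qed.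

Lemma ler_mx_normM m n p (A : 'M[C]_(m, n)) (B : 'M[C]_(n, p)) :
  `|A *m B| <= n%:R * `|A| * `|B|.
Proof.
apply: mx_norm_le => [|i j]; first by rewrite !mulr_ge0 ?ler0n.
rewrite mxE; apply: le_trans (ler_norm_sum _ _ _) _.
apply: le_trans (_ : \sum_(l < n) `|A| * `|B| <= _); last first.
  by rewrite sumr_const card_ord -mulrA mulr_natl.
by apply: ler_sum => l _; rewrite normrM ler_pM ?ler_mx_entry.
Qed.

Lemma ler_mx_normM_trans m n p (A : 'M[C]_(m, n)) (B : 'M[C]_(n, p)) (a b : C) :
  `|A| <= a -> `|B| <= b -> `|A *m B| <= n%:R * a * b.
Proof.
move=> Aa Bb; apply: le_trans (ler_mx_normM _ _) _.
by rewrite ler_pM ?mulr_ge0 ?ler_wpM2l ?ler0n.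
Qed.

Lemma ler_mx_norm_tr m n (A : 'M[C]_(m, n)) : `|A^T| <= `|A|.
Proof. by apply: mx_norm_le => // i j; rewrite mxE ler_mx_entry. Qed.

Lemma ler_mx_norm_conj m n (A : 'M[C]_(m, n)) : `|A ^ Num.conj| <= `|A|.
Proof. by apply: mx_norm_le => // i j; rewrite mxE norm_conjC ler_mx_entry. Qed.

Lemma mulmx_adj_diag m n (S : 'M[C]_(m, n)) i :
  (S *m S^t*) i i = \sum_j `|S i j| ^+ 2.
Proof. by rewrite mxE; apply: eq_bigr => j _; rewrite !mxE -normCK. Qed.

Lemma ler_entry_gram m n (S : 'M[C]_(m, n)) (b : C) i j :
  (S *m S^t*) i i <= b -> `|S i j| ^+ 2 <= b.
Proof.
apply: le_trans; rewrite mulmx_adj_diag (bigD1 j) //= lerDl.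
by apply: sumr_ge0 => l _; rewrite exprn_ge0.
Qed.

(** A change of basis that turns A into the identity turns the diagonal of the Gram
    matrix into sums of squared moduli of entries; the constant is the cost of
    changing back, so it depends neither on S nor on its number of rows. *)
Lemma posdef_gram_bound n (A : 'M[C]_n) : posdef_hermitian A ->
  exists2 K : C, 0 <= K &
    forall m (S : 'M[C]_(m, n)) (b : C), 0 <= b ->
      (forall i, (S *m A *m S^t*) i i <= b) -> `|S| <= K * sqrtC b.
Proof.
move=> A_pos; have [T [_ [T_unit TA _]]] := posdef_simultaneous_diag A_pos A_pos.1.
exists (n%:R * `|T|) => [|m S b b_ge0 S_le]; first by rewrite mulr_ge0 ?ler0n.
have SE : S = S *m invmx T *m T by rewrite mulmxKV.
rewrite {1}SE -mulrA [_ * sqrtC b]mulrC mulrA.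
apply: ler_mx_normM_trans => //; apply: mx_norm_le => [|i j].
  by rewrite sqrtC_ge0.
rewrite -(@ler_pXn2r _ 2) ?nnegrE ?sqrtC_ge0 // sqrtCK.
apply: ler_entry_gram; apply: le_trans (S_le i).
have -> : S *m A *m S^t* = S *m invmx T *m (T *m A *m T^t*) *m (S *m invmx T)^t*.
  by rewrite -sandwichM -SE.
by rewrite TA mulmx1.
Qed.

End EntrywiseNorm.

(** * Principal angles *)

Section PrincipalAngles.
Variables (R : realType) (u : nat) (G : 'M[R[i]]_u).
Hypothesis G_pos : posdef_hermitian G.
Local Notation C := R[i].
Local Notation g := (invmx G).

Let g_pos : posdef_hermitian g.
Proof. exact: posdef_inv. Qed.

Let g_adj : g^t* = g.
Proof. exact/hermsymP/g_pos.1. Qed.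

Lemma orthoC p q (V : 'M[C]_(p, u)) (W : 'M[C]_(q, u)) :
  V *m g *m W^t* = 0 -> W *m g *m V^t* = 0.
Proof. by move=> VW; apply: adj_eq0; rewrite !adjM trmxCK g_adj mulmxA. Qed.

Lemma gramD p (V W : 'M[C]_(p, u)) :
  V *m g *m W^t* = 0 -> gram G (V + W) = gram G V + gram G W.
Proof.
move=> VW; rewrite /gram adjD !mulmxDl !mulmxDr VW (orthoC VW).
by rewrite addr0 add0r.
Qed.

(** The orthogonal projections are defined by a complement, so they mean what they
    should only because a definite form splits the space. *)
Lemma addsmx_orthomx p (L : 'M[C]_(p, u)) :
  row_full (<<L>> + orthomx Num.conj g L)%MS.
Proof.
have [_ g_gt0] := g_pos; set O := orthomx _ _ _.
have cap0 : (<<L>> :&: O)%MS = 0.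
  apply/eqP/rowV0P => v; rewrite sub_capmx genmxE => /andP[/submxP[w ->]].
  move=> /sub_kermxP vO; apply/eqP; apply: contraT => /g_gt0.
  by rewrite formE adjM mulmxA -[_ *m g *m _]mulmxA vO mul0mx mxE ltxx.
apply/eqP; have := mxrank_sum_cap <<L>>%MS O; rewrite cap0 mxrank0 addn0 => ->.
rewrite mxrank_gen mxrank_ker.
have -> : \rank (g *m L^t*) = \rank L.
  rewrite -(mxrank_tr L) -(mxrank_map Num.conj L^T).
  apply/eqP; rewrite eqn_leq mxrankM_maxr /=.
  by rewrite -{1}[L^t*](mulKmx (posdef_unit g_pos)) mxrankM_maxr.
by rewrite subnKC // rank_leq_col.
Qed.

Lemma ortho_projP p q (L : 'M[C]_(p, u)) (W : 'M[C]_(q, u)) :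
  (W *m ortho_proj G L <= L)%MS /\
  W *m ortho_proj G L *m g *m (W - W *m ortho_proj G L)^t* = 0.
Proof.
set X := W *m ortho_proj G L.
have XL : (X <= L)%MS by rewrite -(genmxE L) proj_mx_sub.
split=> //; have /submxP[Z XE] := XL.
have /sub_kermxP YL : (W - X <= orthomx Num.conj g L)%MS.
  apply: proj_mx_compl_sub; apply: submx_full; exact: addsmx_orthomx.
have X_adj : X^t* = L^t* *m Z^t* by rewrite -adjM -XE.
by apply: orthoC; rewrite X_adj mulmxA -[_ *m g *m _]mulmxA YL mul0mx.
Qed.

(** The angle bound quantifies over all families of canonical angles, so it has
    content only because such a family exists.  It comes from diagonalizing
    simultaneously the inner product on S and its pull-back along the projection;
    by Pythagoras the eigenvalues lie between 0 and 1, so they are squared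
    cosines. *)
Lemma canonical_angles_exist p q (L : 'M[C]_(p, u)) (S : 'M[C]_(q, u)) :
  exists (theta : 'I_(\rank S) -> R) (V : 'M[C]_(\rank S, u)),
    [/\ canonical_angles G L theta, (V :=: S)%MS, gram G V = 1%:M
      & gram G (V *m ortho_proj G L) = diag_mx (\row_j (cos (theta j) ^+ 2)%:C)].
Proof.
set P := ortho_proj G L; set S0 := row_base S.
have S0_pos : posdef_hermitian (S0 *m g *m S0^t*).
  by apply: posdef_congr => //; exact: row_base_free.
have B_herm : (S0 *m P) *m g *m (S0 *m P)^t* \is hermsymmx.
  exact: hermsym_congr g_pos.1.
have [T [l [T_unit TA TB]]] := posdef_simultaneous_diag S0_pos B_herm.
pose V := T *m S0.
have VS : (V :=: S)%MS.
  apply: eqmx_trans (eq_row_base S); apply: eqmxMfull.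
  by rewrite row_full_unit.
have gV : gram G V = 1%:M by rewrite /gram /V sandwichM.
have gVP : gram G (V *m P) = diag_mx (cplx l).
  by rewrite /gram /V -(mulmxA T) sandwichM.
have [_ ortho] := ortho_projP L V.
have gVD : gram G (V - V *m P) = 1%:M - diag_mx (cplx l).
  by have := gramD ortho; rewrite subrKC gV gVP => ->; rewrite [RHS]addrC addKr.
have l_ge0 j : 0 <= l 0 j.
  rewrite -ler0c; have := form_ge0 (row j (V *m P)) g_pos.
  by rewrite -gram_diag -/(gram G _) gVP !mxE eqxx mulr1n.
have l_le1 j : l 0 j <= 1.
  rewrite -subr_ge0 -ler0c; have := form_ge0 (row j (V - V *m P)) g_pos.
  by rewrite -gram_diag -/(gram G _) gVD !mxE eqxx mulr1n rmorphB.
have s_itv j : -1 <= Num.sqrt (l 0 j) <= 1.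
  rewrite (le_trans (lerN10 _) (sqrtr_ge0 _)) /=.
  by rewrite -[leRHS]sqrtr1 ler_wsqrtr.
pose theta j := acos (Num.sqrt (l 0 j)).
have cosE j : cos (theta j) = Num.sqrt (l 0 j) by rewrite acosK // in_itv /= s_itv.
have gVP' : gram G (V *m P) = diag_mx (\row_j (cos (theta j) ^+ 2)%:C).
  by rewrite gVP; congr diag_mx; apply/rowP => j; rewrite !mxE cosE sqr_sqrtr.
exists theta, V; split=> //; split=> [j|].
  rewrite acos_ge0 ?s_itv //=.
  rewrite leNgt -ltr_cos ?in_itv /= ?acos_ge0 ?acos_lepi ?s_itv
          ?divr_ge0 ?pi_ge0 //=.
    by rewrite cosE cos_pihalf -leNgt sqrtr_ge0.
  by rewrite ler_pdivrMr // ler_pMr ?pi_gt0 // ler1n.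
by split=> [j|]; [rewrite cosE sqrtr_ge0|exists V].
Qed.

(** If no vector of S is nearly orthogonal to L, an orthonormal basis V of S has a
    bounded dual basis W inside L: take V made of right singular vectors and divide
    their projections by the squared cosines. *)
Lemma dual_frame_of_angles (kappa : R) : 0 < kappa ->
  exists2 K : C, 0 <= K &
    forall p q (L : 'M[C]_(p, u)) (S : 'M[C]_(q, u)),
      (forall theta : 'I_(\rank S) -> R,
         canonical_angles G L theta -> forall j, kappa <= cos (theta j)) ->
      exists (V W : 'M[C]_(\rank S, u)),
        [/\ (V :=: S)%MS, (W <= L)%MS, V *m g *m W^t* = 1%:M, `|V| <= K & `|W| <= K].
Proof.
move=> kappa_gt0; have [K0 K0_ge0 bound] := posdef_gram_bound g_pos.
have kappaC : 0 <= (kappa^-2)%:C by rewrite ler0c invr_ge0 exprn_ge0 // ltW.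
exists (K0 * (1 + sqrtC (kappa^-2)%:C)) => [|p q L S S_angles].
  by rewrite mulr_ge0 // addr_ge0 // sqrtC_ge0.
have [theta [V [angles VS gV gVP]]] := canonical_angles_exist L S.
have cos_ge j : kappa <= cos (theta j) by exact: S_angles.
have cos_gt0 j : 0 < cos (theta j) by exact: lt_le_trans (cos_ge j).
have [PL ortho] := ortho_projP L V.
set P := ortho_proj G L in gVP PL ortho.
pose e : 'rV[C]_(\rank S) := \row_j (cos (theta j) ^- 2)%:C.
have e_real : e \is a realmx.
  by apply/mxOverP => i j; rewrite !mxE; apply/complex_realP; eexists.
have eK (d : 'rV[C]_(\rank S)) : d = \row_j (cos (theta j) ^+ 2)%:C ->
    diag_mx d *m diag_mx e = 1%:M.
  move=> ->; rewrite mulmx_diag; apply/matrixP => i j; rewrite !mxE.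
  by rewrite -rmorphM mulfV // expf_neq0 // gt_eqF.
exists V, (diag_mx e *m (V *m P)); split=> //.
- by rewrite mulmx_sub.
- rewrite adjM (adj_diag_real e_real) mulmxA.
  suff -> : V *m g *m (V *m P)^t* = gram G (V *m P) by rewrite gVP eK.
  by apply/eqP; rewrite /gram -subr_eq0 -!mulmxBl (orthoC ortho).
- apply: le_trans (bound _ V 1 _ _) _ => // [i|].
    by rewrite -/(gram G V) gV mxE eqxx.
  by rewrite ler_wpM2l // sqrtC1 lerDl sqrtC_ge0.
apply: le_trans (bound _ _ _ kappaC _) _; last by rewrite ler_wpM2l // lerDr.
move=> i; rewrite sandwichM -/(gram G _) gVP (adj_diag_real e_real).
rewrite -mulmxA eK // mulmx1 !mxE eqxx mulr1n lecR.
by rewrite lef_pV2 ?posrE ?exprn_gt0 // lerXn2r ?nnegrE ?cos_ge // ltW.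
Qed.

End PrincipalAngles.

(** * Projections onto the generalized eigenspaces *)

Section EigenProjections.
Variable R : realType.
Local Notation C := R[i].

Lemma conj_cplx p q (A : 'M[R]_(p, q)) : map_mx Num.conj (cplx A) = cplx A.
Proof. by apply/matrixP => i j; rewrite !mxE; exact: conjc_real. Qed.

Lemma conj_pencil n p q (N : 'I_n.+1 -> 'M[R]_(p, q)) k lambda :
  lambda \is Num.real -> map_mx Num.conj (pencil N k lambda) = pencil N k lambda.
Proof.
move=> /CrealP lambda_real.
by rewrite map_mxD map_mxZ !conj_cplx rmorphN /= lambda_real.
Qed.

(** Membership of the rows of P in Psi_L N0 is what makes the projections for
    different eigenvalues annihilate each other, by the
    same computation as for left and right eigenvectors of a single matrix. *)
Definition is_eigenprojection n p u (N : 'I_n.+1 -> 'M[R]_(p, u)) k lambda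
    (P : 'M[C]_u) : Prop :=
  [/\ pencil N k lambda *m P = 0,
      forall v : 'cV[C]_u, pencil N k lambda *m v = 0 -> P *m v = v
    & exists2 X : 'M[C]_(u, p), P = X *m cplx (N ord0) & X *m pencil N k lambda = 0].

(** The projection is the sum of the products of the basis vectors of Phi_R with the
    dual covectors.  The dual basis lives in Phi_L, so lowering its index gives
    conjugates of covectors X N0 with X in Psi_L; as lambda is real the pencil is
    real and these conjugates are again of that form. *)
Lemma eigenprojection_bound n p u (nrm : 'rV[R]_n -> R) (G : 'M[C]_u)
    (N : 'I_n.+1 -> 'M[R]_(p, u)) :
  posdef_hermitian G -> hyperbolic nrm N -> uniform_angle_bound nrm N G ->
  exists2 K : C, 0 <= K &
    forall k lambda, nrm k = 1 -> generalized_eigenvalue N k lambda ->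
      exists2 P : 'M[C]_u, is_eigenprojection N k lambda P & `|P| <= K.
Proof.
move=> G_pos [_ hyp] [vartheta [_ cos_gt0 angles]].
have [K K_ge0 frame] := dual_frame_of_angles G_pos cos_gt0.
exists (u%:R * (u%:R * K * K) * `|invmx G|) => [|k lambda nrm_k lambda_eig].
  by rewrite !mulr_ge0 ?ler0n.
have lambda_real := hyp _ _ nrm_k lambda_eig.
have [V [W [VS /submxP[Y WE] VW V_le W_le]]] := frame _ _ (PhiL N G k lambda)
  (PhiR N k lambda) (angles k lambda nrm_k lambda_eig).
pose g := invmx G; rewrite -/g in VW.
have GgT : map_mx Num.conj G *m g^T = 1%:M.
  have /hermsymP G_adj := G_pos.1.
  by rewrite -{1}G_adj map_mxCK -trmx_mul mulVmx ?trmx1 // posdef_unit.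
pose X := V^T *m map_mx Num.conj (Y *m PsiL N k lambda).
have VK : pencil N k lambda *m V^T = 0.
  have /sub_kermxP E : (V <= kermx (pencil N k lambda)^T)%MS by rewrite VS.
  by apply: trmx_inj; rewrite trmx_mul trmxK E trmx0.
have XN : X *m cplx (N ord0) = V^T *m (map_mx Num.conj W *m g^T).
  rewrite WE /PhiL !mulmxA !map_mxM conj_cplx /X !map_mxM -!mulmxA GgT.
  by rewrite mulmx1.
exists (V^T *m (map_mx Num.conj W *m g^T)).
  split.
  - by rewrite mulmxA VK mul0mx.
  - move=> v v_ker.
    have /submxP[a vE] : (v^T <= V)%MS.
      by rewrite VS; apply/sub_kermxP; rewrite -trmx_mul v_ker trmx0.
    have -> : v = V^T *m a^T by rewrite -trmx_mul -vE trmxK.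
    rewrite -!mulmxA; congr (_ *m _).
    rewrite !mulmxA -[RHS]mul1mx; congr (_ *m _).
    apply: trmx_inj; rewrite trmx1 -VW !trmx_mul !trmxK map_trmx.
    by rewrite mulmxA.
  exists X => //.
  rewrite /X -mulmxA -(conj_pencil N k lambda_real) -map_mxM -mulmxA.
  by rewrite (mulmx_ker (pencil N k lambda)) mulmx0 map_mx0 mulmx0.
rewrite mulmxA; apply: ler_mx_normM_trans; last exact: ler_mx_norm_tr.
apply: (@le_trans _ _ ((\rank (PhiR N k lambda))%:R * K * K)).
  apply: ler_mx_normM_trans.
    exact: le_trans (ler_mx_norm_tr _) V_le.
  exact: le_trans (ler_mx_norm_conj _) W_le.
by rewrite -!mulrA ler_wpM2r ?mulr_ge0 // ler_nat rank_leq_col.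
Qed.

End EigenProjections.

(** * Diagonalization of sums of idempotents *)

Section IdempotentFamilies.
Variable R : realType.
Local Notation C := R[i].

(** H = sum_i Q_i^* Q_i is a symmetrizer of D = sum_i mu_i Q_i, since
    H D = sum_i mu_i Q_i^* Q_i is hermitian.  Diagonalizing H and H D simultaneously
    gives T with T^* H T = 1, which bounds every Q_i T, hence T = sum_i Q_i T, and
    gives the inverse T^* H of T explicitly. *)
Lemma diag_of_idempotents (I : finType) u (Q : I -> 'M[C]_u) (mu : I -> R) (K : C) :
  \sum_i Q i = 1%:M -> (forall i j, i != j -> Q i *m Q j = 0) ->
  (forall i, `|Q i| <= K) ->
  exists (T : 'M[C]_u) (Lambda : 'rV[R]_u),
    [/\ T \in unitmx,
        \sum_i (mu i)%:C *: Q i = T *m diag_mx (cplx Lambda) *m invmx T,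
        `|T| <= #|I|%:R
      & `|invmx T| <= u%:R * #|I|%:R * (#|I|%:R * (u%:R * K * K))].
Proof.
move=> sumQ orthoQ Q_le; set D := \sum_i _.
have QQ i : Q i *m Q i = Q i.
  rewrite -[RHS]mulmx1 -sumQ mulmx_sumr (bigD1 i) //= big1 ?addr0 // => j ji.
  by rewrite orthoQ // eq_sym.
have QD i : Q i *m D = (mu i)%:C *: Q i.
  rewrite mulmx_sumr (bigD1 i) //= big1 ?addr0 => [|j ji].
    by rewrite -scalemxAr QQ.
  by rewrite -scalemxAr orthoQ ?scaler0 // eq_sym.
pose H := \sum_i (Q i)^t* *m Q i.
have conjH (S : 'M[C]_u) : S^t* *m H *m S = \sum_i (Q i *m S)^t* *m (Q i *m S).
  rewrite mulmx_sumr mulmx_suml; apply: eq_bigr => i _.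
  by rewrite adjM !mulmxA.
have adj_sum (F : I -> 'M[C]_u) : (\sum_i F i)^t* = \sum_i (F i)^t*.
  by rewrite linear_sum raddf_sum.
have H_herm : H \is hermsymmx.
  by apply/hermsymP; rewrite adj_sum; apply: eq_bigr => i _; rewrite adjM trmxCK.
have HDE : H *m D = \sum_i (mu i)%:C *: ((Q i)^t* *m Q i).
  by rewrite mulmx_suml; apply: eq_bigr => i _; rewrite -mulmxA QD scalemxAr.
have HD_herm : H *m D \is hermsymmx.
  apply/hermsymP; rewrite HDE adj_sum; apply: eq_bigr => i _.
  have mu_conj : Num.conj (mu i)%:C = (mu i)%:C by exact: conjc_real.
  by rewrite linearZ map_mxZ adjM trmxCK /= mu_conj.
have H_pos : posdef_hermitian H.
  split=> // w w_neq0; rewrite formE.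
  have -> : (w *m H *m w^t*) 0 0 = \sum_i \sum_j `|(w *m (Q i)^t*) 0 j| ^+ 2.
    rewrite mulmx_sumr mulmx_suml summxE; apply: eq_bigr => i _.
    by rewrite -mulmx_adj_diag adjM trmxCK !mulmxA.
  rewrite lt_def sumr_ge0 ?andbT => [|i _]; last first.
    by apply: sumr_ge0 => j _; rewrite exprn_ge0.
  apply: contra w_neq0 => /eqP sum0; apply/eqP.
  suff wQ0 i : w *m (Q i)^t* = 0.
    rewrite -[w]mulmx1 -(map_mx1 Num.conj) -trmx1 -sumQ adj_sum mulmx_sumr.
    by rewrite big1.
  have row_ge0 l : true -> 0 <= \sum_j `|(w *m (Q l)^t*) 0 j| ^+ 2.
    by move=> _; apply: sumr_ge0 => j _; rewrite exprn_ge0.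
  have row_eq0 := psumr_eq0P row_ge0 sum0 (i := i) isT.
  apply/rowP => j; rewrite [RHS]mxE.
  have entry_ge0 l : true -> 0 <= `|(w *m (Q i)^t*) 0 l| ^+ 2.
    by rewrite exprn_ge0.
  have /eqP := psumr_eq0P entry_ge0 row_eq0 (i := j) isT.
  by rewrite expf_eq0 normr_eq0 /= => /eqP.
have [S [Lambda [S_unit SH SHD]]] := posdef_simultaneous_diag H_pos HD_herm.
pose T := S^t*.
have TH : T^t* *m H *m T = 1%:M by rewrite trmxCK.
have T_unit : T \in unitmx by have [] := mulmx1_unit TH.
have TV : invmx T = T^t* *m H.
  by rewrite -[RHS](mulmxK T_unit) TH mul1mx.
have QT_le i a j : `|(Q i *m T) a j| <= 1.
  rewrite -(@ler_pXn2r _ 2) ?nnegrE // expr1n.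
  have <- : (T^t* *m H *m T) j j = 1 by rewrite TH mxE eqxx.
  rewrite conjH summxE (bigD1 i) //=.
  have diagE l : ((Q l *m T)^t* *m (Q l *m T)) j j = \sum_b `|(Q l *m T) b j| ^+ 2.
    rewrite mxE; apply: eq_bigr => b _; rewrite [X in X * _]mxE [X in X^* * _]mxE.
    by rewrite mulrC -normCK.
  rewrite diagE (bigD1 a) //= -addrA lerDl.
  apply: addr_ge0; apply: sumr_ge0 => l _; rewrite ?exprn_ge0 // diagE.
  by apply: sumr_ge0 => b _; rewrite exprn_ge0.
have T_le : `|T| <= #|I|%:R.
  apply: mx_norm_le => [|a j]; first exact: ler0n.
  rewrite -[T]mul1mx -sumQ mulmx_suml summxE.
  apply: le_trans (ler_norm_sum _ _ _) _.
  apply: le_trans (_ : \sum_(i : I) 1 <= _); first by apply: ler_sum.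
  by rewrite sumr_const.
have adj_le m p (A : 'M[C]_(m, p)) : `|A^t*| <= `|A|.
  exact: le_trans (ler_mx_norm_conj _) (ler_mx_norm_tr _).
exists T, Lambda; split=> //.
  have : T^t* *m (H *m D) *m T = diag_mx (cplx Lambda) by rewrite trmxCK.
  by rewrite mulmxA -TV => <-; rewrite !mulmxA mulmxV // mul1mx mulmxK.
rewrite TV; apply: ler_mx_normM_trans; first exact: le_trans (adj_le _ _ _) _.
apply: le_trans (ler_norm_sum _ _ _) _.
apply: le_trans (_ : \sum_(i : I) u%:R * K * K <= _).
  apply: ler_sum => i _; apply: ler_mx_normM_trans => //.
  exact: le_trans (adj_le _ _ _) _.
by rewrite sumr_const [leRHS]mulr_natl.
Qed.

End IdempotentFamilies.

(** * Linear algebra at a fixed wave vector *)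

Section EigenvalueEnumeration.
Variables (R : realType) (n p u : nat) (N : 'I_n.+1 -> 'M[R]_(p, u)) (k : 'rV[R]_n).
Local Notation C := R[i].

(** A left inverse of N0 sends the right kernel of the pencil to eigenvectors of a
    single square matrix. *)
Lemma generalized_eigenvalues_finite : row_full (N ord0) ->
  exists (r : nat) (l : 'I_r -> C),
    [/\ (r <= u)%N, injective l
      & forall lambda, generalized_eigenvalue N k lambda <-> exists i, lambda = l i].
Proof.
move=> N0_full; pose A := cplx (pinvmx (N ord0)) *m cplx (spatial N k).
have [rs char_rs] := closed_field_poly_normal (char_poly A^T).
move: char_rs; rewrite (monicP (char_poly_monic _)) scale1r => char_rs.
have eig_root lambda : generalized_eigenvalue N k lambda -> lambda \in rs.
  case=> v v_neq0 v_ker.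
  have Av : A *m v = lambda *: v.
    have : cplx (pinvmx (N ord0)) *m (pencil N k lambda *m v) = 0.
      by rewrite v_ker mulmx0.
    rewrite mulmxA mulmxDr -scalemxAr -map_mxM mulVpmx // map_mx1 mulmxDl.
    by rewrite -scalemxAl mul1mx scaleNr addrC => /subr0_eq.
  rewrite -root_prod_XsubC -char_rs -eigenvalue_root_char.
  apply/eigenvalueP; exists v^T; first by rewrite -trmx_mul Av linearZ.
  by apply: contra v_neq0 => /eqP v0; rewrite -[v]trmxK v0 trmx0.
pose s := undup [seq lambda <- rs | `[< generalized_eigenvalue N k lambda >]].
exists (size s), (fun i => nth 0 s i); split.
- apply: leq_trans (size_undup _) _; rewrite size_filter.
  apply: leq_trans (count_size _ _) _.
  have := size_char_poly A^T; rewrite char_rs size_prod_XsubC => -[->].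
  exact: leqnn.
- move=> i j /eqP; rewrite nth_uniq ?undup_uniq // => /eqP; exact: val_inj.
move=> lambda; split=> [lambda_eig|[i ->]].
  have lambda_s : lambda \in s.
    by rewrite mem_undup mem_filter eig_root // andbT; apply/asboolP.
  have lt_s : (index lambda s < size s)%N by rewrite index_mem.
  by exists (Ordinal lt_s); rewrite nth_index.
have := mem_nth 0 (ltn_ord i); rewrite mem_undup mem_filter => /andP[/asboolP].
by [].
Qed.

End EigenvalueEnumeration.

Section FixedWaveVector.
Variables (R : realType) (n u c : nat).
Variables (N : 'I_n.+1 -> 'M[R]_(u + c, u)) (C : 'I_n.+1 -> 'M[R]_(c, u + c)).
Variable k : 'rV[R]_n.
Hypothesis C_geroch : geroch_fields N C.
Hypothesis C_rank : row_free (C ord0).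
Local Notation N0 := (cplx (N ord0)).
Local Notation K := (cplx (spatial N k)).
Local Notation C0 := (cplx (C ord0)).
Local Notation S := (cplx (spatial C k)).

Lemma geroch_time : C0 *m N0 = 0.
Proof.
rewrite -map_mxM; have := C_geroch ord0 ord0 => /eqP.
rewrite -mulr2n -scaler_nat scaler_eq0 pnatr_eq0 /= => /eqP ->.
by rewrite map_mx0.
Qed.

Lemma geroch_mixed : S *m N0 = - (C0 *m K).
Proof.
rewrite -!map_mxM -map_mxN; congr (cplx _); apply/eqP; rewrite -addr_eq0.
rewrite mulmx_suml mulmx_sumr -big_split big1 // => i _ /=.
by rewrite -scalemxAl -scalemxAr -scalerDr C_geroch scaler0.
Qed.

(** The quadratic form in k of the antisymmetric array C^i N^j vanishes. *)
Lemma geroch_spatial : S *m K = 0.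
Proof.
rewrite -map_mxM; suff -> : spatial C k *m spatial N k = 0 by rewrite map_mx0.
set X := _ *m _.
have XE : X = \sum_(i < n) \sum_(j < n)
    (k 0 i * k 0 j) *: (C (lift ord0 i) *m N (lift ord0 j)).
  rewrite /X mulmx_suml; apply: eq_bigr => i _; rewrite mulmx_sumr.
  by apply: eq_bigr => j _; rewrite -scalemxAl -scalemxAr scalerA.
have : X + X = 0.
  rewrite {2}XE exchange_big /= XE -big_split big1 // => i _ /=.
  rewrite -big_split big1 // => j _ /=.
  by rewrite [k 0 j * _]mulrC -scalerDr C_geroch scaler0.
by move/eqP; rewrite -mulr2n -scaler_nat scaler_eq0 pnatr_eq0 /= => /eqP.
Qed.

Variable h0 : 'M[R[i]]_(u, u + c).
Hypothesis h0N : h0 *m N0 = 1%:M.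
Local Notation H := (companion h0 C0).

Lemma companion_geroch :
  [/\ C0 *m H = 1%:M, h0 *m H = 0 & N0 *m h0 + H *m C0 = 1%:M].
Proof. by apply: companionP => //; [exact: geroch_time|rewrite row_free_map]. Qed.

Lemma principal_symbol_split : K = N0 *m (h0 *m K) + H *m (C0 *m K).
Proof.
by have [_ _ E] := companion_geroch; rewrite !mulmxA -mulmxDl E mul1mx.
Qed.

(** Both equal - S N0 h0 K: on the left because S N0 = - C0 K, on the right because
    S annihilates K = N0 h0 K + H C0 K.  It makes the kernel of the constraint
    symbol stable under the evolution symbol. *)
Lemma constraint_intertwining :
  C0 *m K *m (h0 *m K) = S *m H *m (C0 *m K).
Proof.
have := geroch_spatial; rewrite {1}principal_symbol_split mulmxDr !mulmxA.
rewrite geroch_mixed !mulNmx => /eqP.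
by rewrite addrC subr_eq0 => /eqP E; exact: esym.
Qed.

Variables (r : nat) (l : 'I_r -> R[i]) (P : 'I_r -> 'M[R[i]]_u).
Hypothesis l_inj : injective l.
Hypothesis l_eig : forall lambda,
  generalized_eigenvalue N k lambda -> exists i, lambda = l i.
Hypothesis P_eig : forall i, is_eigenprojection N k (l i) (P i).

Lemma pencilE lambda q (B : 'M[R[i]]_(u, q)) :
  pencil N k lambda *m B = K *m B - lambda *: (N0 *m B).
Proof. by rewrite mulmxDl -scalemxAl scaleNr addrC. Qed.

Lemma eigenprojection_right i : K *m P i = l i *: (N0 *m P i).
Proof. by have [+ _ _] := P_eig i; rewrite pencilE => /subr0_eq. Qed.

Lemma eigenprojection_left i :
  exists2 X : 'M[R[i]]_(u, u + c), P i = X *m N0 & X *m K = l i *: P i.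
Proof.
have [_ _ [X PX Xker]] := P_eig i; exists X => //.
move: Xker; rewrite mulmxDr -scalemxAr scaleNr addrC => /subr0_eq ->.
by rewrite PX.
Qed.

Lemma eigenprojection_fix i (v : 'cV[R[i]]_u) :
  K *m v = l i *: (N0 *m v) -> P i *m v = v.
Proof. by move=> Kv; have [_ + _] := P_eig i; apply; rewrite pencilE Kv subrr. Qed.

Lemma eigenprojection_ortho i j : i != j -> P i *m P j = 0.
Proof.
move=> ij; have [X PX XK] := eigenprojection_left i.
have : X *m (K *m P j) = l j *: (P i *m P j).
  by rewrite eigenprojection_right -scalemxAr mulmxA -PX.
rewrite mulmxA XK -scalemxAl => /eqP; rewrite -subr_eq0 -scalerBl scaler_eq0.
by rewrite subr_eq0 (inj_eq l_inj) (negPf ij) /= => /eqP.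
Qed.

Lemma eigenprojection_idem i : P i *m P i = P i.
Proof.
apply/matrixP => a b; pose e : 'cV[R[i]]_u := delta_mx b 0.
have /eigenprojection_fix : K *m (P i *m e) = l i *: (N0 *m (P i *m e)).
  by rewrite !mulmxA eigenprojection_right -scalemxAl.
by rewrite mulmxA -!colE => /matrixP/(_ a 0); rewrite ![col _ _ _ _]mxE.
Qed.

Lemma constraint_eigenprojection i : C0 *m K *m P i = 0.
Proof.
rewrite -mulmxA eigenprojection_right -scalemxAr mulmxA geroch_time.
by rewrite mul0mx scaler0.
Qed.

Lemma eigenprojection_sum i : P i *m (\sum_j P j) = P i.
Proof.
rewrite mulmx_sumr (bigD1 i) //= eigenprojection_idem big1 ?addr0 // => j ji.
by rewrite eigenprojection_ortho // eq_sym.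
Qed.

(** The common kernel of the constraint symbol and of the sum of the projections is
    stable under h0 K.  Were it non-zero, it would contain an eigenvector, which
    solves the pencil equation and so is fixed by one of the projections that
    annihilate it.  In particular h0 K has no Jordan block on the kernel of the
    constraint symbol. *)
Lemma eigenprojections_span (v : 'cV[R[i]]_u) :
  C0 *m K *m v = 0 -> (\sum_i P i) *m v = v.
Proof.
set V := C0 *m K; set A := h0 *m K; set Ps := \sum_i P i.
have KA w : V *m w = 0 -> K *m w = N0 *m (A *m w) :> 'cV_(u + c).
  move=> Vw; rewrite {1}principal_symbol_split mulmxDl -!mulmxA.
  by rewrite [C0 *m _]mulmxA -/V Vw mulmx0 addr0.
(* Rows of Z are the transposes of the vectors killed by both V and Ps. *)
pose Z := kermx (row_mx V^T Ps^T).
have ZP (w : 'cV_u) : reflect (V *m w = 0 /\ Ps *m w = 0) (w^T <= Z)%MS.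
  apply: (iffP sub_kermxP); rewrite mul_mx_row -!trmx_mul.
    move/(congr1 (fun X => (lsubmx X, rsubmx X))).
    rewrite row_mxKl row_mxKr linear0 linear0 => -[Vw Pw].
    by split; apply: trmx_inj; rewrite trmx0.
  by move=> [-> ->]; rewrite !trmx0 row_mx0.
have A_stable (w : 'cV_u) : (w^T <= Z)%MS -> ((A *m w)^T <= Z)%MS.
  move=> /ZP[Vw Pw]; apply/ZP; split.
    by rewrite mulmxA constraint_intertwining -mulmxA Vw mulmx0.
  rewrite mulmx_suml big1 // => i _; have [X PX XK] := eigenprojection_left i.
  rewrite PX -mulmxA -KA // mulmxA XK -scalemxAl.
  by rewrite -eigenprojection_sum -mulmxA Pw mulmx0 scaler0.
have Z_stable : stablemx Z A^T.
  apply/rV_subP => w /submxP[a ->]; rewrite mulmxA.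
  have aZ : (((a *m Z)^T)^T <= Z)%MS by rewrite trmxK submxMl.
  by have := A_stable _ aZ; rewrite trmx_mul !trmxK.
have Z0 : Z = 0.
  apply/eqP; apply: contraT => Z_neq0.
  have [|mu /eigenvalueP[w w_eig w_neq0]] :=
    @eigenvalue_closed _ _ (restrictmx Z A^T); first by rewrite lt0n mxrank_eq0.
  pose z := (w *m row_base Z)^T.
  have z_neq0 : z != 0.
    apply: contra w_neq0 => /eqP z0.
    by rewrite -(mulmx_free_eq0 _ (row_base_free Z)) -[_ *m _]trmxK -/z z0 trmx0.
  have Zz : (z^T <= Z)%MS by rewrite trmxK mulmx_sub // eq_row_base.
  have Az : A *m z = mu *: z.
    apply: trmx_inj; rewrite trmx_mul linearZ /= trmxK scalemxAl -w_eig /conjmx.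
    by rewrite -[RHS]mulmxA mulmxKpV ?stablemx_row_base //; exact/esym/mulmxA.
  have [Vz Pz] := ZP _ Zz.
  have Kz : K *m z = mu *: (N0 *m z) by rewrite KA // Az -scalemxAr.
  have [i mu_i] : exists i, mu = l i.
    by apply: l_eig; exists z => //; rewrite pencilE Kz subrr.
  have Piz : P i *m z = z by apply: eigenprojection_fix; rewrite -mu_i.
  by rewrite -Piz -eigenprojection_sum -mulmxA Pz mulmx0 eqxx in z_neq0.
move=> Vv; apply/esym/eqP; rewrite -subr_eq0.
suff /ZP : V *m (v - Ps *m v) = 0 /\ Ps *m (v - Ps *m v) = 0.
  rewrite Z0 submx0 => /eqP E; apply/eqP.
  by apply: trmx_inj; rewrite E trmx0.
split; rewrite mulmxBr ?Vv.
  rewrite mulmxA mulmx_sumr big1 ?mul0mx ?subr0 // => i _.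
  exact: constraint_eigenprojection.
suff PsPs : Ps *m Ps = Ps by rewrite mulmxA PsPs subrr.
by rewrite {1}/Ps mulmx_suml; apply: eq_bigr => i _; exact: eigenprojection_sum.
Qed.

(** All reductions are h0 + Y C0, so they can realize any evolution symbol that
    agrees with h0 K on the kernel of C0 K; the one chosen here vanishes on
    the common kernel of the projections. *)
Lemma reduction_to_eigenprojections :
  exists h : 'M[R[i]]_(u, u + c),
    h *m N0 = 1%:M /\ h *m K = \sum_i l i *: P i.
Proof.
set V := C0 *m K; set A := h0 *m K; set D := \sum_i _; pose Ps := \sum_i P i.
have AP i : A *m P i = l i *: P i.
  by rewrite -mulmxA eigenprojection_right -scalemxAr mulmxA h0N mul1mx.
have DPs : (D - A) *m Ps = 0.
  rewrite mulmxBl mulmx_suml mulmx_sumr -sumrB big1 // => i _.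
  by rewrite -scalemxAl eigenprojection_sum AP subrr.
have Ps_coker : Ps *m cokermx V = cokermx V.
  apply/matrixP => a b; pose e : 'cV[R[i]]_u := delta_mx b 0.
  have /eigenprojections_span : V *m (cokermx V *m e) = 0.
    by rewrite mulmxA mulmx_coker mul0mx.
  by rewrite mulmxA -!colE => /matrixP/(_ a 0); rewrite ![col _ _ _ _]mxE.
have /submxP[Y DA] : (D - A <= V)%MS.
  by rewrite submxE -Ps_coker mulmxA DPs mul0mx.
exists (h0 + Y *m C0); split.
  by rewrite mulmxDl h0N -mulmxA geroch_time mulmx0 addr0.
by rewrite mulmxDl -mulmxA -/V -DA addrC subrK.
Qed.

End FixedWaveVector.

(** * The hyperbolization and its subsidiary system *)

Section Assembly.
Variable R : realType.

(** When the evolution symbol is annihilated by the constraint symbol, so is, by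
    intertwining, the part of the subsidiary symbol that the reduction determines;
    its rows then belong to the left kernel that the extra fields span. *)
Lemma constraint_symbol_cancel n u c m (N : 'I_n.+1 -> 'M[R]_(u + c, u))
    (C : 'I_n.+1 -> 'M[R]_(c, u + c)) (k : 'rV[R]_n) (h : 'M[R[i]]_(u, u + c))
    (Mk : 'M[R]_(m, c)) :
  geroch_fields N C -> row_free (C ord0) -> h *m cplx (N ord0) = 1%:M ->
  cplx (C ord0) *m cplx (spatial N k) *m (h *m cplx (spatial N k)) = 0 ->
  (Mk :=: kermx (C ord0 *m spatial N k))%MS ->
  exists Q : 'M[R[i]]_(c, m),
    cplx (spatial C k) *m companion h (cplx (C ord0)) + Q *m cplx Mk = 0.
Proof.
move=> C_geroch C_rank hN Vh0 MkE; set B := _ *m companion _ _.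
have /submxP[W ->] : (B <= cplx Mk)%MS.
  have : (B <= kermx (cplx (C ord0 *m spatial N k)))%MS.
    by apply/sub_kermxP; rewrite map_mxM -constraint_intertwining.
  by move/submx_trans; apply; rewrite -map_kermx map_submx MkE.
by exists (- W); rewrite mulNmx subrr.
Qed.

(** The complementary idempotent, with eigenvalue 0, completes the family; at most
    u + 1 idempotents occur, so that the bound does not involve their number. *)
Lemma spectral_sum_diag u r (P : 'I_r -> 'M[R[i]]_u) (l : 'I_r -> R[i]) (K : R[i]) :
  (r <= u)%N -> (forall i, l i \is Num.real) ->
  (forall i, P i *m P i = P i) -> (forall i j, i != j -> P i *m P j = 0) ->
  0 <= K -> (forall i, `|P i| <= K) ->
  let b := u.+1%:R : R[i] in
  let K' := 1 + b * K in
  exists (T : 'M[R[i]]_u) (Lambda : 'rV[R]_u),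
    [/\ T \in unitmx,
        \sum_i l i *: P i = T *m diag_mx (cplx Lambda) *m invmx T
      & `|T| + `|invmx T| <= b + u%:R * b * (b * (u%:R * K' * K'))].
Proof.
move=> r_le l_real idemP orthoP K_ge0 P_le b K'; set P0 := 1%:M - \sum_i P i.
have b_ge0 : 0 <= b by exact: ler0n.
have K'_ge0 : 0 <= K' by rewrite addr_ge0 // mulr_ge0.
have PsP i : (\sum_j P j) *m P i = P i.
  by rewrite mulmx_suml (bigD1 i) //= idemP big1 ?addr0 // => j ji; rewrite orthoP.
have PPs i : P i *m (\sum_j P j) = P i.
  rewrite mulmx_sumr (bigD1 i) //= idemP big1 ?addr0 // => j ji.
  by rewrite orthoP // eq_sym.
have P0P i : P0 *m P i = 0 by rewrite mulmxBl mul1mx PsP subrr.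
have PP0 i : P i *m P0 = 0 by rewrite mulmxBr mulmx1 PPs subrr.
(* Index 0 carries the complementary idempotent, index i + 1 the given P i. *)
pose Q (j : 'I_r.+1) := oapp P P0 (unlift ord0 j).
pose mu (j : 'I_r.+1) := oapp (fun i => complex.Re (l i)) 0 (unlift ord0 j).
have Q0 : Q ord0 = P0 by rewrite /Q unlift_none.
have QS i : Q (lift ord0 i) = P i by rewrite /Q liftK.
have Q_sum : \sum_j Q j = 1%:M.
  by rewrite big_ord_recl Q0 (eq_bigr P) ?subrK // => i _; rewrite QS.
have Q_ortho i j : i != j -> Q i *m Q j = 0.
  case: (unliftP ord0 i) => [i' ->|->]; case: (unliftP ord0 j) => [j' ->|->];
    rewrite ?Q0 ?QS ?eqxx // (inj_eq lift_inj); exact: orthoP.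
have Q_le i : `|Q i| <= K'.
  case: (unliftP ord0 i) => [i' ->|->]; rewrite ?Q0 ?QS.
    apply: le_trans (P_le i') _; rewrite /K' /b mulrSr mulrDl mul1r addrA.
    by rewrite lerDr addr_ge0 // mulr_ge0 ?ler0n.
  apply: le_trans (ler_normB _ _) _; apply: lerD.
    apply: mx_norm_le => // a e; rewrite mxE; case: eqP; rewrite ?normr1 //.
    by rewrite normr0.
  apply: le_trans (ler_norm_sum _ _ _) _.
  apply: le_trans (_ : \sum_(i < r) K <= _); first by apply: ler_sum.
  rewrite sumr_const card_ord -mulr_natl ler_wpM2r // ler_nat.
  exact: leq_trans r_le (leqnSn u).
have [T [Lambda [T_unit E T_le TV_le]]] := diag_of_idempotents mu Q_sum Q_ortho Q_le.
have rb : #|'I_r.+1|%:R <= b by rewrite card_ord ler_nat ltnS.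
exists T, Lambda; split=> //.
  rewrite -E big_ord_recl /mu unlift_none /= scale0r add0r.
  by apply: eq_bigr => i _; rewrite liftK /= QS RRe_real.
apply: lerD; first exact: le_trans T_le rb.
apply: le_trans TV_le _.
by rewrite !(ler_pM, mulr_ge0, ler0n, ler_wpM2l).
Qed.

Lemma uniformly_diagonalizable_0 n p (nrm : 'rV[R]_n -> R)
    (B : 'rV[R]_n -> 'M[R[i]]_p) :
  (forall k, nrm k = 1 -> B k = 0) -> uniformly_diagonalizable nrm B.
Proof.
move=> B0; exists 3; first exact: ltr0n.
move=> k /B0 ->; exists 1%:M, 0; split; first exact: unitmx1.
  by rewrite map_mx0 linear0 mulmx0 mul0mx.
have one_le : `|1%:M : 'M[R[i]]_p| <= 1.
  apply: mx_norm_le => // a e; rewrite mxE; case: eqP; rewrite ?normr1 //.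
  by rewrite normr0.
rewrite invmx1; apply: le_lt_trans (lerD one_le one_le) _.
have -> : 1 + 1 = (2%:R)%:C :> R[i] by rewrite rmorph_nat.
by rewrite ltcR ltr_nat.
Qed.

End Assembly.

Theorem theorem12 (R : realType) (n u c m : nat)
    (nrm : 'rV[R]_n -> R) (nrmP : is_norm nrm)
    (G : 'M[R[i]]_u) (GP : posdef_hermitian G)
    (N : 'I_n.+1 -> 'M[R]_(u + c, u))
    (C : 'I_n.+1 -> 'M[R]_(c, u + c))
    (M : 'I_n.+1 -> 'M[R]_(m, u + c))
    (no_alg : no_algebraic_constraints N)
    (* (i) *)
    (hyp : hyperbolic nrm N)
    (angles : uniform_angle_bound nrm N G)
    (* (ii) *)
    (C_geroch : geroch_fields N C)
    (C_rank : row_free (C ord0))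
    (* (iii) *)
    (M_extra : extra_geroch_fields N M)
    (M_span : forall Y : 'I_n.+1 -> 'rV[R]_(u + c), extra_geroch_fields N Y ->
       exists w : 'rV[R]_m, forall a, Y a = w *m M a)
    (* (iv) *)
    (C_integrable : integrability N C)
    (M_integrable : integrability N (fun d => reduced_field N C M d *m C ord0))
    (* (v) *)
    (M_kernel : forall k : 'rV[R]_n, nrm k = 1 ->
       (spatial (reduced_field N C M) k :=: kermx (C ord0 *m spatial N k))%MS) :
  exists (h : 'rV[R]_n -> 'M[R[i]]_(u, u + c)) (Q : 'rV[R]_n -> 'M[R[i]]_(c, m)),
    hyperbolization nrm N h /\
    uniformly_diagonalizable nrm (subsidiary_symbol N C M h Q).
Proof.
have N_full : row_full (N ord0).
  rewrite -cokermx_eq0; apply: contraT => /matrix0Pn[i [j coker_neq0]].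
  case: hyp.1; exists (col j (cokermx (N ord0))).
    by apply: contra coker_neq0 => /eqP/matrixP/(_ i 0); rewrite !mxE => ->.
  by rewrite colE mulmxA mulmx_coker mul0mx.
pose h0 := cplx (pinvmx (N ord0)).
have h0N : h0 *m cplx (N ord0) = 1%:M by rewrite -map_mxM mulVpmx // map_mx1.
have [K K_ge0 projections] := eigenprojection_bound GP hyp angles.
pose b : R[i] := u.+1%:R; pose K' := 1 + b * K.
pose bound := b + u%:R * b * (b * (u%:R * K' * K')).
have pointwise k : exists hQ : 'M[R[i]]_(u, u + c) * 'M[R[i]]_(c, m), nrm k = 1 ->
    [/\ hQ.1 *m cplx (N ord0) = 1%:M,
        exists (T : 'M[R[i]]_u) (Lambda : 'rV[R]_u),
          [/\ T \in unitmx,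
              hQ.1 *m cplx (spatial N k) = T *m diag_mx (cplx Lambda) *m invmx T
            & `|T| + `|invmx T| <= bound]
      & cplx (spatial C k) *m companion hQ.1 (cplx (C ord0)) +
        hQ.2 *m cplx (spatial (reduced_field N C M) k) = 0].
  have [nrm_k|nrm_k] := EM (nrm k = 1); last by exists (0, 0).
  have [r [l [r_le l_inj l_eig]]] := generalized_eigenvalues_finite k N_full.
  have l_gen i : generalized_eigenvalue N k (l i) by apply/l_eig; exists i.
  have /choice[P P_spec] i : exists P : 'M[R[i]]_u,
      is_eigenprojection N k (l i) P /\ `|P| <= K.
    by have [P ? ?] := projections _ _ nrm_k (l_gen i); exists P.
  have P_eig i := (P_spec i).1.
  have l_all lambda := (l_eig lambda).1.
  have [h [hN hK]] :=
    reduction_to_eigenprojections C_geroch C_rank h0N l_inj l_all P_eig.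
  have Vh : cplx (C ord0) *m cplx (spatial N k) *m (h *m cplx (spatial N k)) = 0.
    rewrite hK mulmx_sumr big1 // => i _; rewrite -scalemxAr.
    by rewrite (constraint_eigenprojection C_geroch P_eig) scaler0.
  have [Q BQ] := constraint_symbol_cancel C_geroch C_rank hN Vh (M_kernel k nrm_k).
  exists (h, Q) => _; split=> //=; rewrite hK.
  apply: spectral_sum_diag => // [i|i|i j|i].
  - exact: hyp.2 nrm_k (l_gen i).
  - exact: eigenprojection_idem P_eig i.
  - exact: eigenprojection_ortho l_inj P_eig i j.
  - exact: (P_spec i).2.
have /choice[hQ hQ_spec] := pointwise.
exists (fun k => (hQ k).1), (fun k => (hQ k).2); split; last first.
  by apply: uniformly_diagonalizable_0 => k /hQ_spec[_ _].
split=> [k /hQ_spec[]//|].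
have b_ge0 : 0 <= b by exact: ler0n.
have K'_ge0 : 0 <= K' by rewrite addr_ge0 // mulr_ge0.
have bound_ge0 : 0 <= bound by rewrite addr_ge0 // !mulr_ge0 ?ler0n.
have boundE : (complex.Re bound)%:C = bound by rewrite RRe_real // ger0_real.
exists (complex.Re bound + 1) => [|k nrm_k].
  by rewrite ltr_wpDl // -ler0c boundE.
have [_ [T [Lambda [T_unit E T_le]]] _] := hQ_spec k nrm_k.
exists T, Lambda; split=> //; apply: le_lt_trans T_le _.
by rewrite -[ltLHS]boundE ltcR ltrDl.
Qed.
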